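(* Let $G$ be a finite group, $K\le G$ a subgroup, $(\theta,V)$ an irreducible representation of $K$, and $v\in V$ with $\|v\|=1$. Let $J$, $m_\sigma$, $\phi^\sigma_{i,j}$, $\psi$, $\mathcal H(G,K,\psi)$ and $\mathcal F$ be as defined in the context. (1) The set $\{\phi^\sigma_{i,j}:\sigma\in J,\ i,j=1,2,\ldots,m_\sigma\}$ is an orthogonal basis for $\mathcal H(G,K,\psi)$ and $\|\phi^\sigma_{i,j}\|^2_{L(G)}=\frac{|G|}{d_\sigma}$. In particular, the Fourier inversion formula is $$f=\frac1{|G|}\sum_{\sigma\in J}d_\sigma\sum_{i,j=1}^{m_\sigma}[\mathcal Ff(\sigma)]_{i,j}\,\phi^\sigma_{i,j}\qquad(f\in\mathcal H(G,K,\psi)).$$ (2) The map $\mathcal H(G,K,\psi)\to\bigoplus_{\sigma\in J}M_{m_\sigma,m_\sigma}(\mathbb C)$, $f\mapsto\mathcal Ff$, is an isomorphism of algebras. (3) Set $\phi^\sigma=\sum_{i=1}^{m_\sigma}\phi^\sigma_{i,i}$ and suppose that $\varphi^\sigma$ is the irreducible character of $\mathcal H(G,K,\psi)$ corresponding to $M_{m_\sigma,m_\sigma}(\mathbb C)$. Then $$\varphi^\sigma(f)=\chi^\sigma(f)=\sum_{g\in G}f(g)\overline{\phi^\sigma(g)}\qquad\text{for all }f\in\mathcal H(G,K,\psi).$$ Moreover, the $\phi^\sigma$'s satisfy the orthogonality relations $$\langle\phi^\sigma,\phi^\rho\rangle=\delta_{\sigma,\rho}\frac{|G|m_\sigma}{d_\sigma}\qquad(\sigma,\rho\in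 J).$$
   Context: Scalar products are Hermitian and linear in the first argument; all representations are finite-dimensional, complex and unitary; $d_\sigma$ is the dimension of $\sigma$. $\mathrm{Hom}(A,B)$ and its subspaces carry the scalar product $\langle T_1,T_2\rangle=\frac1{\dim A}\mathrm{tr}(T_2^*T_1)$; $\mathrm{Hom}_K$ is the space of $K$-intertwining operators. $L(G)$ is the space of functions $f:G\to\mathbb C$ with scalar product $\langle f_1,f_2\rangle=\sum_{g\in G}f_1(g)\overline{f_2(g)}$ and convolution $(f_1*f_2)(g)=\sum_{g_0\in G}f_1(gg_0^{-1})f_2(g_0)$. $M_{m,m}(\mathbb C)$ is the algebra of complex $m\times m$ matrices. $\psi\in L(G)$ is given by $\psi(k)=\frac{d_\theta}{|K|}\langle v,\theta(k)v\rangle$ for $k\in K$ and $\psi=0$ off $K$. The Hecke algebra is $\mathcal H(G,K,\psi)=\{\psi*f*\psi:f\in L(G)\}=\{f\in L(G):f=\psi*f*\psi\}$, an algebra under convolution. $\{(\sigma,W_\sigma):\sigma\in J\}$ is a complete set of pairwise inequivalent irreducible $G$-representations contained in $\mathrm{Ind}_K^GV$ and $m_\sigma$ is the multiplicity of $W_\sigma$ in $\mathrm{Ind}_K^GV$. For every $\sigma\in J$ an orthonormal basis $\{L_{\sigma,1},\ldots,L_{\sigma,m_\sigma}\}$ of $\mathrm{Hom}_K(V,\mathrm{Res}^G_KW_\sigma)$ is fixed; $w^\sigma_i=L_{\sigma,i}v$ and $\phi^\sigma_{i,j}(g)=\langle w^\sigma_i,\sigma(g)w^\sigma_j\rangle$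 for $g\in G$, $i,j=1,\ldots,m_\sigma$. For $f\in\mathcal H(G,K,\psi)$, the Fourier transform at $\sigma\in J$ is the $m_\sigma\times m_\sigma$ matrix with entries $[\mathcal Ff(\sigma)]_{i,j}=\langle f,\phi^\sigma_{i,j}\rangle_{L(G)}$, and $\mathcal Ff=\bigoplus_{\sigma\in J}\mathcal Ff(\sigma)$. The irreducible character of $\mathcal H(G,K,\psi)$ corresponding to $M_{m_\sigma,m_\sigma}(\mathbb C)$ is the trace of the irreducible representation $f\mapsto\mathcal Ff(\sigma)$ on $\mathbb C^{m_\sigma}$. $\chi^\sigma$ is the character of $(\sigma,W_\sigma)$ and $\chi^\sigma(f)=\sum_{g\in G}\chi^\sigma(g)f(g)$ for $f\in L(G)$. $\delta_{\sigma,\rho}=1$ if $\sigma,\rho$ are equivalent and $0$ otherwise. *)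

(* Defs.v *)
From HB Require Import structures.
From mathcomp Require Import all_boot all_order all_algebra fingroup.
From mathcomp Require Import sesquilinear boolp classical_sets.
Set Implicit Arguments.
Unset Strict Implicit.
Unset Printing Implicit Defensive.
Import passmx GroupScope Order.TTheory GRing.Theory Num.Theory Num.Def.
Local Open Scope ring_scope.

Section LinearOperators.
Variable C : numClosedFieldType.

Definition lftrace (V : vectType C) (f : 'End(V)) : C :=
  \tr (mxof (vbasis {:V}) (vbasis {:V}) f).

Variables (A B : vectType C) (dA : {dot A for conjC}) (dB : {dot B for conjC}).

Definition is_adjoint (T : 'Hom(A, B)) (S : 'Hom(B, A)) : Prop :=
  forall x y, dB (T x) y = dA x (S y).

(* Chosen operator; adjointP shows that the defining property always holds. *)
Definition adjoint (T : 'Hom(A, B)) : 'Hom(B, A) :=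
  xget 0 (is_adjoint T).

Let e := vbasis {:A}.

Let gram (z : A) : 'rV[C]_(\dim {:A}) := \row_i (dA e`_i z)^*.

Let gram_linear : linear gram.
Proof.
move=> a u w; apply/rowP => i; rewrite !mxE linearPr /=.
by rewrite rmorphD rmorphM /= conjCK.
Qed.
HB.instance Definition _ := GRing.isSemilinear.Build _ _ _ _ gram
  (GRing.semilinear_linear gram_linear).

Let gramT (T : 'Hom(A, B)) (y : B) : 'rV[C]_(\dim {:A}) :=
  \row_i (dB (T e`_i) y)^*.

Let gramT_linear T : linear (gramT T).
Proof.
move=> a u w; apply/rowP => i; rewrite !mxE linearPr /=.
by rewrite rmorphD rmorphM /= conjCK.
Qed.
HB.instance Definition _ T := GRing.isSemilinear.Build _ _ _ _ (gramT T)
  (GRing.semilinear_linear (gramT_linear T)).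

Let gram_inj z : gram z = 0 -> z = 0.
Proof.
move=> /rowP gz; apply/eqP; rewrite -(dnorm_eq0 dA); apply/eqP.
rewrite {1}(coord_vbasis (memvf z)) linear_sumlz big1 // => i _.
have := gz i; rewrite !mxE => /eqP; rewrite conjC_eq0 => /eqP h.
by rewrite linearZl_LR /= h mulr0.
Qed.

Lemma adjointP (T : 'Hom(A, B)) : is_adjoint T (adjoint T).
Proof.
suff [S hS] : exists S, is_adjoint T S by exact: (xgetI 0 hS).
pose Rz := linfun gram.
have kerR : lker Rz == 0%VS.
  apply/lker0P => u w; rewrite !lfunE /= => h; apply/eqP.
  by rewrite -subr_eq0; apply/eqP/gram_inj; rewrite linearB /= h subrr.
have imR : limg Rz = fullv.
  apply/eqP; rewrite eqEdim subvf /= limg_dim_eq ?(eqP kerR) ?capv0 //.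
  by rewrite !dimvf /dim /= mul1n.
exists (Rz^-1 \o linfun (gramT T))%VF => x y.
rewrite comp_lfunE /=; set z := (Rz^-1)%VF _.
have hz : gram z = gramT T y.
  have -> : gram z = Rz z by rewrite lfunE.
  by rewrite limg_lfunVK ?imR ?memvf // lfunE.
rewrite (coord_vbasis (memvf x)) linear_sum !linear_sumlz.
apply: eq_bigr => i _; rewrite linearZ !linearZl_LR /=; congr (_ * _).
by have /rowP/(_ i) := hz; rewrite !mxE => /(can_inj (@conjCK _)).
Qed.

Definition Hom_dot (T1 T2 : 'Hom(A, B)) : C :=
  (\dim {:A})%:R^-1 * lftrace (adjoint T2 \o T1)%VF.

End LinearOperators.

(* Operators are only constrained on H; the values of [act] off H are junk.   *)
Record unitary_rep (C : numClosedFieldType) (gT : finGroupType)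
    (H : {group gT}) := UnitaryRep {
  space :> vectType C;
  udot : {dot space for conjC};
  act : gT -> 'End(space);
  act1 : act 1%g = \1%VF;
  actM : {in H &, forall g h, act (g * h)%g = (act g \o act h)%VF};
  act_unitary : {in H, forall g x y, udot (act g x) (act g y) = udot x y}
}.

Section Representations.
Variables (C : numClosedFieldType) (gT : finGroupType) (H : {group gT}).
Implicit Types A B : unitary_rep C H.

Definition rep_invariant A (U : {vspace A}) : Prop :=
  forall h, h \in H -> (act A h @: U <= U)%VS.

Definition rep_irreducible A : Prop :=
  (0 < \dim {:A})%N /\
  forall U : {vspace A}, rep_invariant U -> U = 0%VS \/ U = fullv.

Definition hom_defect A B (h : gT) (T : 'Hom(A, B)) : 'Hom(A, B) :=
  (T \o act A h)%VF - (act B h \o T)%VF.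

Fact hom_defect_linear A B h : linear (@hom_defect A B h).
Proof.
move=> a S T; apply/lfunP => x; rewrite /hom_defect.
do 8!rewrite ?(lfunE, comp_lfunE) /=.
by rewrite linearD linearZ /= scalerBr opprD addrACA.
Qed.
HB.instance Definition _ A B h := GRing.isSemilinear.Build _ _ _ _
  (@hom_defect A B h) (GRing.semilinear_linear (@hom_defect_linear A B h)).

(* The space Hom_H(A, B) of intertwining operators. *)
Definition Hom_rep A B : {vspace 'Hom(A, B)} :=
  (\bigcap_(h in H) lker (linfun (@hom_defect A B h)))%VS.

Lemma Hom_repP A B (T : 'Hom(A, B)) :
  reflect {in H, forall h x, T (act A h x) = act B h (T x)}
          (T \in Hom_rep A B).
Proof.
rewrite memvE; apply: (iffP subv_bigcapP) => [hT h hH x|hT h hH].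
  have := hT h hH; rewrite -memvE memv_ker lfunE /= subr_eq0 => /eqP/lfunP.
  by move/(_ x); rewrite !comp_lfunE.
rewrite -memvE memv_ker lfunE /= subr_eq0; apply/eqP/lfunP => x.
by rewrite !comp_lfunE hT.
Qed.

Definition rep_equiv A B : Prop :=
  exists2 T : 'Hom(A, B), T \in Hom_rep A B & bijective T.

Definition rep_contained A B : Prop :=
  exists2 T : 'Hom(A, B), T \in Hom_rep A B & injective T.

(* B is the direct sum of m copies of A and of an invariant complement that   *)
(* contains no copy of A; meant for irreducible A.                            *)
Definition rep_multiplicity A B (m : nat) : Prop :=
  exists (T : 'I_m -> 'Hom(A, B)) (U : {vspace B}),
    [/\ forall i, T i \in Hom_rep A B /\ injective (T i),
        rep_invariant U,
        forall S : 'Hom(A, B),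
          S \in Hom_rep A B -> (limg S <= U)%VS -> ~ injective S,
        directv (\sum_i limg (T i) + U)
      & (\sum_i limg (T i) + U)%VS = fullv].

Definition rep_char A (g : gT) : C := lftrace (act A g).

End Representations.

Section Restriction.
Variables (C : numClosedFieldType) (gT : finGroupType) (K : {group gT}).
Variable W : unitary_rep C [set: gT]%G.

Fact Res_actM :
  {in K &, forall g h, act W (g * h)%g = (act W g \o act W h)%VF}.
Proof. by move=> g h _ _; apply: actM; rewrite inE. Qed.

Fact Res_act_unitary :
  {in K, forall g x y, udot W (act W g x) (act W g y) = udot W x y}.
Proof. by move=> g _; apply: act_unitary; rewrite inE. Qed.

Definition Res : unitary_rep C K :=
  UnitaryRep (act1 W) Res_actM Res_act_unitary.

End Restriction.

Section Induction.
Variables (C : numClosedFieldType) (gT : finGroupType) (K : {group gT}).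
Variable V : unitary_rep C K.

Local Notation FV := {ffun gT -> V}.

Definition ind_defect (k : gT) (F : FV) : FV :=
  [ffun g => F (g * k)%g - act V k^-1%g (F g)].

Fact ind_defect_linear k : linear (ind_defect k).
Proof.
move=> a F1 F2; apply/ffunP => g.
by rewrite !ffunE linearD linearZ /= scalerBr opprD addrACA.
Qed.
HB.instance Definition _ k := GRing.isSemilinear.Build _ _ _ _
  (ind_defect k) (GRing.semilinear_linear (ind_defect_linear k)).

Definition Ind_space : {vspace FV} :=
  (\bigcap_(k in K) lker (linfun (ind_defect k)))%VS.

Lemma Ind_spaceP (F : FV) :
  reflect {in K, forall k g, F (g * k)%g = act V k^-1%g (F g)}
          (F \in Ind_space).
Proof.
rewrite memvE; apply: (iffP subv_bigcapP) => hF k kK.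
  move=> g; have := hF k kK; rewrite -memvE memv_ker lfunE => /eqP/ffunP/(_ g).
  by rewrite !ffunE => /eqP; rewrite subr_eq0 => /eqP.
rewrite -memvE memv_ker lfunE; apply/eqP/ffunP => g.
by rewrite !ffunE hF // subrr.
Qed.

Definition ltrans (g : gT) (F : FV) : FV := [ffun x => F (g^-1 * x)%g].

Fact ltrans_linear g : linear (ltrans g).
Proof. by move=> a F1 F2; apply/ffunP => x; rewrite !ffunE. Qed.
HB.instance Definition _ g := GRing.isSemilinear.Build _ _ _ _
  (ltrans g) (GRing.semilinear_linear (ltrans_linear g)).

Fact ltrans_Ind g F : F \in Ind_space -> ltrans g F \in Ind_space.
Proof.
by move=> /Ind_spaceP hF; apply/Ind_spaceP => k kK x; rewrite !ffunE mulgA hF.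
Qed.

Definition Ind_act (g : gT) : 'End(subvs_of Ind_space) :=
  linfun (vsproj Ind_space \o ltrans g \o vsval).

Lemma Ind_actE g F : vsval (Ind_act g F) = ltrans g (vsval F).
Proof. by rewrite lfunE /= vsprojK // ltrans_Ind // subvsP. Qed.

Definition Ind_dot (F1 F2 : subvs_of Ind_space) : C :=
  #|K|%:R^-1 * \sum_(g : gT) udot V (vsval F1 g) (vsval F2 g).

Fact Ind_dot_bilinear : bilinear_for *%R (conjC \; *%R) Ind_dot.
Proof.
split=> [F2 a u w|F1 a u w]; rewrite /Ind_dot /= mulrCA -mulrDr;
  congr (_ * _); rewrite mulr_sumr -big_split; apply: eq_bigr => g _ /=;
  rewrite !ffunE.
- by rewrite linearDl linearZl_LR.
- by rewrite linearDr linearZr_LR.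
Qed.
HB.instance Definition _ := bilinear_isBilinear.Build C _ _ _
  _ _ Ind_dot Ind_dot_bilinear.

Fact Ind_dot_herm F1 F2 : Ind_dot F1 F2 = (-1) ^+ false * (Ind_dot F2 F1)^*.
Proof.
rewrite expr0 mul1r /Ind_dot rmorphM fmorphV rmorph_nat rmorph_sum /=.
by congr (_ * _); apply: eq_bigr => g _; rewrite hermC /= expr0 mul1r.
Qed.
HB.instance Definition _ :=
  isHermitianSesquilinear.Build C _ false conjC Ind_dot Ind_dot_herm.

Fact Ind_dot_gt0 F : F != 0 -> 0 < Ind_dot F F.
Proof.
move=> nzF; rewrite /Ind_dot mulr_gt0 ?invr_gt0 ?ltr0n ?cardG_gt0 //.
have [g nzg] : exists g, vsval F g != 0.
  apply/existsP; apply: contraR nzF => /existsPn h; apply/eqP/val_inj/ffunP.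
  by move=> g; rewrite ffunE; apply/eqP; have := h g; rewrite negbK.
by rewrite (bigD1 g) //= ltr_wpDr ?neq0_dnorm_gt0 ?sumr_ge0.
Qed.
HB.instance Definition _ := isDotProduct.Build C _ Ind_dot Ind_dot_gt0.

Fact Ind_act1 : Ind_act 1%g = \1%VF.
Proof.
apply/lfunP => F; apply: val_inj; rewrite /= Ind_actE lfunE /=.
by apply/ffunP => x; rewrite ffunE invg1 mul1g.
Qed.

Fact Ind_actM : {in [set: gT]%G &, forall g h,
  Ind_act (g * h)%g = (Ind_act g \o Ind_act h)%VF}.
Proof.
move=> g h _ _; apply/lfunP => F; apply: val_inj.
rewrite /= comp_lfunE !Ind_actE.
by apply/ffunP => x; rewrite !ffunE invMg mulgA.
Qed.

Fact Ind_act_unitary : {in [set: gT]%G, forall g x y,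
  Ind_dot (Ind_act g x) (Ind_act g y) = Ind_dot x y}.
Proof.
move=> g _ x y; rewrite /Ind_dot; congr (_ * _); rewrite !Ind_actE.
rewrite [RHS](reindex_inj (mulgI g^-1%g)) /=.
by apply: eq_bigr => z _; rewrite !ffunE.
Qed.

(* Functions F : G -> V with F(gk) = theta(k^-1) F(g), acted upon by left     *)
(* translations.                                                              *)
Definition Ind : unitary_rep C [set: gT]%G :=
  @UnitaryRep C gT [set: gT]%G (subvs_of Ind_space) Ind_dot
    Ind_act Ind_act1 Ind_actM Ind_act_unitary.

End Induction.

(* C^o makes the function space a vectType over C. *)
Notation LG C gT := {ffun gT -> C^o}.

Section GroupAlgebra.
Variables (C : numClosedFieldType) (gT : finGroupType).
Implicit Types f : LG C gT.

Definition LG_dot f1 f2 : C := \sum_(g : gT) f1 g * (f2 g)^*.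

Fact LG_dot_bilinear : bilinear_for *%R (conjC \; *%R) LG_dot.
Proof.
split=> [f2 a u w|f1 a u w]; rewrite /LG_dot /= mulr_sumr -big_split;
  apply: eq_bigr => g _ /=; rewrite !ffunE /=.
- by rewrite mulrDl mulrA.
- by rewrite rmorphD rmorphM /= mulrDr mulrCA.
Qed.
HB.instance Definition _ := bilinear_isBilinear.Build C _ _ _
  _ _ LG_dot LG_dot_bilinear.

Fact LG_dot_herm f1 f2 : LG_dot f1 f2 = (-1) ^+ false * (LG_dot f2 f1)^*.
Proof.
rewrite expr0 mul1r /LG_dot rmorph_sum /=.
by apply: eq_bigr => g _; rewrite rmorphM /= conjCK mulrC.
Qed.
HB.instance Definition _ :=
  isHermitianSesquilinear.Build C _ false conjC LG_dot LG_dot_herm.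

Fact LG_dot_gt0 f : f != 0 -> 0 < LG_dot f f.
Proof.
move=> nzf; rewrite /LG_dot.
have [g nzg] : exists g, f g != 0.
  apply/existsP; apply: contraR nzf => /existsPn h; apply/eqP/ffunP.
  by move=> g; rewrite ffunE; apply/eqP; have := h g; rewrite negbK.
rewrite (bigD1 g) //= ltr_wpDr ?mul_conjC_gt0 ?sumr_ge0 // => x _.
exact: mul_conjC_ge0.
Qed.
HB.instance Definition _ := isDotProduct.Build C _ LG_dot LG_dot_gt0.

Definition conv f1 f2 : LG C gT :=
  [ffun g => \sum_(g0 : gT) f1 (g * g0^-1)%g * f2 g0].

Lemma convA f1 f2 f3 : conv f1 (conv f2 f3) = conv (conv f1 f2) f3.
Proof.
apply/ffunP => g; rewrite !ffunE.
under eq_bigr => x _ do rewrite ffunE mulr_sumr.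
rewrite exchange_big /=; apply: eq_bigr => y _.
rewrite ffunE mulr_suml (reindex_inj (mulIg y)) /=.
by apply: eq_bigr => x _; rewrite invMg !mulgA mulgK mulrA.
Qed.

End GroupAlgebra.

Section Hecke.
Variables (C : numClosedFieldType) (gT : finGroupType) (K : {group gT}).
Variables (V : unitary_rep C K) (v : V).

Definition psi : LG C gT :=
  [ffun g => if g \in K then
     (\dim {:V})%:R / #|K|%:R * udot V v (act V g v) else 0].

Definition psi_conj (f : LG C gT) : LG C gT := conv (conv psi f) psi.

Fact psi_conj_linear : linear psi_conj.
Proof.
move=> a f1 f2; apply/ffunP => g; rewrite !ffunE /= scaler_sumr -big_split.
apply: eq_bigr => x _ /=; rewrite !ffunE /= scalerAl -mulrDl; congr (_ * _).
rewrite scaler_sumr -big_split; apply: eq_bigr => y _ /=.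
by rewrite !ffunE /= mulrDr scalerAr.
Qed.
HB.instance Definition _ := GRing.isSemilinear.Build _ _ _ _
  psi_conj (GRing.semilinear_linear psi_conj_linear).

Definition Hecke : {vspace LG C gT} := limg (linfun psi_conj).

Lemma HeckeP f :
  f \in Hecke <-> exists f0, f = conv (conv psi f0) psi.
Proof.
split=> [/memv_imgP[f0 _ ->]|[f0 ->]]; first by exists f0; rewrite lfunE.
by apply/memv_imgP; exists f0; rewrite ?memvf ?lfunE.
Qed.

Lemma Hecke_conv : {in Hecke &, forall f1 f2, conv f1 f2 \in Hecke}.
Proof.
move=> _ _ /HeckeP[f1 ->] /HeckeP[f2 ->]; apply/HeckeP.
by exists (conv (conv f1 psi) (conv psi f2)); rewrite !convA.
Qed.

Variables (W : unitary_rep C [set: gT]%G) (m : nat).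
Variable L : 'I_m -> 'Hom(V, Res K W).

Definition orthonormal_Hom_basis : Prop :=
  basis_of (Hom_rep V (Res K W)) (codom L) /\
  forall i j, Hom_dot (udot V) (udot W) (L i) (L j) = (i == j)%:R.

Definition phi (i j : 'I_m) : LG C gT :=
  [ffun g => udot W (L i v) (act W g (L j v))].

Definition fourier (f : LG C gT) : 'M[C]_m :=
  \matrix_(i, j) LG_dot f (phi i j).

Definition phi_sum : LG C gT := \sum_i phi i i.

Definition Hecke_char (f : LG C gT) : C := \tr (fourier f).

Definition group_char (f : LG C gT) : C := \sum_(g : gT) rep_char W g * f g.

End Hecke.

(* Main.v *)
Require Import Defs.
From HB Require Import structures.
From mathcomp Require Import all_boot all_order all_algebra fingroup.
From mathcomp Require Import sesquilinear spectral reals complex.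
Set Implicit Arguments.
Unset Strict Implicit.
Unset Printing Implicit Defensive.
Import passmx Order.TTheory GRing.Theory Num.Theory Num.Def.
Local Open Scope ring_scope.

(* Write sigma(f) = sum_g f(g) sigma(g), so that F f(sigma)_ij =              *)
(* <sigma(f) w_j, w_i> where w_i = L_i v. By Schur orthogonality on K, psi is *)
(* idempotent and sigma(psi) is the orthogonal projection onto the span of    *)
(* the orthonormal vectors w_i. As f = psi * f * psi on the Hecke algebra, F  *)
(* is multiplicative and its trace is tr sigma(f). Schur orthogonality on G   *)
(* makes the phi_ij orthogonal. If F f = 0 then f acts as zero on every       *)
(* irreducible constituent of Ind V, hence on Ind V, which is faithful on the *)
(* Hecke algebra: so F is injective, and the phi_ij span.                     *)

(** Everything passes through the operators [rep_op], sigma(f) = sum_g f(g) sigma(g), which turn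
    [conv] into composition. Put w_i = L_i v; these are orthonormal because S^* T is a scalar for
    K-intertwiners S, T out of the irreducible V ([Hom_dot_orthonormal]).

    Schur orthogonality on K gives theta(psi) v = v ([psi_reproducing]). Hence psi * psi = psi
    ([conv_psi_psi]), and sigma(psi) is the projection P = sum_i <., w_i> w_i ([rep_op_psi]). For f
    in the Hecke algebra, sigma(f) = P sigma(f) P, so F f(sigma) is the matrix of sigma(f) on the
    range of P ([fourierE]). Inserting P between two factors gives multiplicativity
    ([fourier_conv]), and comparing traces gives the character formula ([Hecke_char_group]).

    Schur orthogonality on G ([phi_dot], [phi_dot_inequiv]) makes the phi_ij orthogonal, so the
    inversion formula defines a right inverse of F ([inverse_fourierK]). F is also injective
    ([fourier_inj]), by [rep_op_eq0] and [rep_op_Ind_inj]. Together these give the inversion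
    formula, and with it that the phi_ij span, without counting dimensions. *)

Section HermitianOperators.
Variable C : numClosedFieldType.
Implicit Types A B : vectType C.

Lemma dotC A (d : {dot A for conjC}) x y : d x y = (d y x)^*.
Proof. by rewrite hermC expr0 mul1r. Qed.

Lemma dot_eqP A (d : {dot A for conjC}) x y :
  (forall z, d x z = d y z) -> x = y.
Proof.
move=> h; apply/eqP; rewrite -subr_eq0 -(dnorm_eq0 d).
by rewrite linearBl /= h subrr.
Qed.

Lemma lftraceE A (f : 'End(A)) :
  lftrace f = \sum_i coord (vbasis {:A}) i (f (vbasis {:A})`_i).
Proof.
rewrite /lftrace /mxtrace; apply: eq_bigr => i _.
by rewrite !mxE /= vecof_delta.
Qed.

Lemma lftraceZ A a (f : 'End(A)) : lftrace (a *: f) = a * lftrace f.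
Proof. by rewrite /lftrace linearZ mxtraceZ. Qed.

Lemma lftrace_sum A I (r : seq I) (P : pred I) (f : I -> 'End(A)) :
  lftrace (\sum_(i <- r | P i) f i) = \sum_(i <- r | P i) lftrace (f i).
Proof. by rewrite /lftrace !linear_sum. Qed.

Lemma lftrace_id A : lftrace (\1 : 'End(A))%VF = (\dim {:A})%:R :> C.
Proof. by rewrite /lftrace mxof1 ?mxtrace1 ?(basis_free (vbasisP _)). Qed.

Section RankOne.
Variables (A B : vectType C) (d : {dot A for conjC}) (x : B) (y : A).

Let rank_one_fun z := d z y *: x.

Fact rank_one_linear : linear rank_one_fun.
Proof. by move=> a u w; rewrite /rank_one_fun linearPl scalerDl scalerA. Qed.
HB.instance Definition _ := GRing.isSemilinear.Build _ _ _ _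
  rank_one_fun (GRing.semilinear_linear rank_one_linear).

Definition rank_one : 'Hom(A, B) := linfun rank_one_fun.

Lemma rank_oneE z : rank_one z = d z y *: x.
Proof. by rewrite lfunE. Qed.

End RankOne.

Lemma lftrace_rank_one A (d : {dot A for conjC}) x y :
  lftrace (rank_one d x y) = d x y.
Proof.
rewrite lftraceE; under eq_bigr => i _ do rewrite rank_oneE linearZ /=.
rewrite {2}(coord_vbasis (memvf x)) linear_sumlz.
by apply: eq_bigr => i _; rewrite linearZl_LR /= mulrC.
Qed.

Lemma eigenvector_exists A (f : 'End(A)) : (0 < \dim {:A})%N ->
  exists2 x, x != 0 & exists a, f x = a *: x.
Proof.
move=> dA; set e := vbasis {:A}.
have [a /eigenvalueP[u uf nzu]] := eigenvalue_closed (mxof e e f) dA.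
have bas := vbasisP {:A}.
exists (vecof e u).
  apply: contraNneq nzu => h.
  by rewrite -(vecofK bas u) h linear0.
by exists a; rewrite (hom_vecof e bas) uf linearZ.
Qed.

End HermitianOperators.

(** * Schur's lemma and Schur orthogonality for unitary representations *)

Section UnitaryRepresentations.
Variables (C : numClosedFieldType) (gT : finGroupType) (H : {group gT}).
Implicit Types A B : unitary_rep C H.

Lemma actKV A h x : h \in H -> act A h (act A h^-1%g x) = x.
Proof.
by move=> hH; rewrite -comp_lfunE -actM ?groupV // mulgV act1 lfunE.
Qed.

Lemma act_adjoint A h x y : h \in H ->
  udot A (act A h x) y = udot A x (act A h^-1%g y).
Proof. by move=> hH; rewrite -{1}(actKV y hH) act_unitary. Qed.

Lemma Schur_bij A B (T : 'Hom(A, B)) : rep_irreducible A -> rep_irreducible B ->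
  T \in Hom_rep A B -> T != 0 -> bijective T.
Proof.
move=> [_ irrA] [_ irrB] /Hom_repP hT nzT.
have kerT : lker T = 0%VS.
  have [|//|kerT] := irrA (lker T).
    move=> h hH; apply/subvP => _ /memv_imgP[x + ->].
    by rewrite !memv_ker hT // => /eqP ->; rewrite linear0.
  case/eqP: nzT; apply/lfunP => x; rewrite lfunE /=; apply/eqP.
  by rewrite -memv_ker kerT memvf.
have imT : limg T = fullv.
  have [|imT|//] := irrB (limg T).
    move=> h hH; apply/subvP => _ /memv_imgP[_ /memv_imgP[x _ ->] ->].
    by rewrite -hT // memv_img ?memvf.
  case/eqP: nzT; apply/lfunP => x; rewrite lfunE /=; apply/eqP.
  by rewrite -memv0 -imT memv_img ?memvf.
exists (T^-1)%VF => x; first by rewrite lker0_lfunK // kerT.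
by rewrite limg_lfunVK // imT memvf.
Qed.

Lemma Schur_scalar A (T : 'End(A)) : rep_irreducible A -> T \in Hom_rep A A ->
  exists a, T = a *: \1%VF.
Proof.
move=> irrA hT; have [x nzx [a Tx]] := eigenvector_exists T irrA.1.
exists a; apply/eqP; rewrite -subr_eq0; apply: contraT => nz.
have hS : T - a *: \1%VF \in Hom_rep A A.
  apply: memvB => //; apply/memvZ/Hom_repP => h _ y.
  by rewrite !lfunE.
have [S SK _] := Schur_bij irrA irrA hS nz.
case/eqP: nzx; rewrite -[x]SK -[RHS]SK linear0; congr (S _).
by rewrite add_lfunE opp_lfunE scale_lfunE id_lfunE Tx subrr.
Qed.

Section MatrixCoefficients.
Variables (A B : unitary_rep C H) (x : A) (x' : B).

(** Averaging a rank-one operator over [H] makes it an intertwiner. Its matrix coefficients are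
    exactly the sums in Schur orthogonality. *)
Definition average_rank_one : 'Hom(B, A) :=
  \sum_(h in H) rank_one (udot B) (act A h x) (act B h x').

Lemma average_rank_one_Hom : average_rank_one \in Hom_rep B A.
Proof.
apply/Hom_repP => k kH b; rewrite /average_rank_one !sum_lfunE linear_sum /=.
rewrite (reindex_inj (mulgI k)) /=.
apply: eq_big => [h|h hH]; first by rewrite groupMl.
have {}hH : h \in H by move: hH; rewrite groupMl.
by rewrite !rank_oneE linearZ /= !actM // !comp_lfunE /= act_unitary.
Qed.

Lemma average_rank_one_dot y y' :
  udot A (average_rank_one y') y =
  \sum_(h in H) udot A (act A h x) y * (udot B (act B h x') y')^*.
Proof.
rewrite /average_rank_one sum_lfunE linear_sumlz; apply: eq_bigr => h _.
by rewrite rank_oneE linearZl_LR mulrC /= -dotC.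
Qed.

End MatrixCoefficients.

Lemma Schur_orthogonality_inequiv A B x y x' y' :
  rep_irreducible A -> rep_irreducible B -> ~ rep_equiv B A ->
  \sum_(h in H) udot A (act A h x) y * (udot B (act B h x') y')^* = 0.
Proof.
move=> irrA irrB neq; rewrite -average_rank_one_dot.
have hT := average_rank_one_Hom x x'.
have [->|nzT] := eqVneq (average_rank_one x x') 0.
  by rewrite lfunE /= linear0l.
by case: neq; exists (average_rank_one x x') => //; apply: Schur_bij.
Qed.

Lemma Schur_orthogonality A x y x' y' : rep_irreducible A ->
  \sum_(h in H) udot A (act A h x) y * (udot A (act A h x') y')^* =
  #|H|%:R / (\dim {:A})%:R * udot A x x' * (udot A y y')^*.
Proof.
move=> irrA; rewrite -average_rank_one_dot -dotC.
have [a Ta] := Schur_scalar irrA (average_rank_one_Hom x x').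
rewrite Ta lfunE /= linearZl_LR lfunE /=; congr (_ * _).
(* The trace determines [a]: by unitarity every summand of the average has trace <x, x'>, so #|H|
   <x, x'> = a dim A. *)
have /(congr1 (@lftrace C A)) := Ta.
rewrite lftrace_sum lftraceZ lftrace_id.
under eq_bigr => h hH do rewrite lftrace_rank_one act_unitary //.
rewrite sumr_const => e.
have nzd : (\dim {:A})%:R != 0 :> C by rewrite pnatr_eq0 -lt0n; case: irrA.
by rewrite mulrAC mulr_natl e mulfK.
Qed.

Lemma Hom_adjoint A B (S T : 'Hom(A, B)) : S \in Hom_rep A B ->
  T \in Hom_rep A B -> (adjoint (udot A) (udot B) S \o T)%VF \in Hom_rep A A.
Proof.
move=> /Hom_repP hS /Hom_repP hT; apply/Hom_repP => h hH x.
have adjP := adjointP (udot A) (udot B) S.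
apply: (@dot_eqP _ _ (udot A)) => y.
rewrite !comp_lfunE act_adjoint // dotC -adjP hT // [RHS]dotC -adjP.
by rewrite hS ?groupV // -dotC act_adjoint // -dotC.
Qed.

(** S^* T is an endomorphism of the irreducible [A], hence a scalar. The normalization 1 / dim A in
    [Hom_dot] makes this scalar equal to <T, S>. *)
Lemma Hom_dot_orthonormal A B (S T : 'Hom(A, B)) x y : rep_irreducible A ->
  S \in Hom_rep A B -> T \in Hom_rep A B ->
  udot B (T x) (S y) = Hom_dot (udot A) (udot B) T S * udot A x y.
Proof.
move=> irrA hS hT; have [a Ea] := Schur_scalar irrA (Hom_adjoint hS hT).
rewrite /Hom_dot Ea lftraceZ lftrace_id.
have nzd : (\dim {:A})%:R != 0 :> C by rewrite pnatr_eq0 -lt0n; case: irrA.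
rewrite mulrCA mulVf // mulr1.
rewrite dotC (adjointP (udot A)) -dotC -comp_lfunE Ea lfunE /=.
by rewrite linearZl_LR lfunE.
Qed.

End UnitaryRepresentations.

(** * Subrepresentations, orthogonal complements and irreducible constituents *)

Section Subrepresentations.
Variables (C : numClosedFieldType) (gT : finGroupType) (H : {group gT}).

Section Subrep.
Variables (A : unitary_rep C H) (U : {vspace A}) (invU : rep_invariant U).

Definition subrep_dot (x y : subvs_of U) : C := udot A (vsval x) (vsval y).

Fact subrep_dot_bilinear : bilinear_for *%R (conjC \; *%R) subrep_dot.
Proof.
by split=> z a x y; rewrite /subrep_dot linearP ?linearPl ?linearPr.
Qed.
HB.instance Definition _ := bilinear_isBilinear.Build C _ _ _
  _ _ subrep_dot subrep_dot_bilinear.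

Fact subrep_dot_herm x y :
  subrep_dot x y = (-1) ^+ false * (subrep_dot y x)^*.
Proof. exact: hermC. Qed.
HB.instance Definition _ :=
  isHermitianSesquilinear.Build C _ false conjC subrep_dot subrep_dot_herm.

Fact subrep_dot_gt0 x : x != 0 -> 0 < subrep_dot x x.
Proof. by move=> nzx; rewrite /subrep_dot dnorm_gt0. Qed.
HB.instance Definition _ := isDotProduct.Build C _ subrep_dot subrep_dot_gt0.

(** [vsproj] makes the operator total: for [h] in [H] it only re-types a vector already in [U],
    while off [H] the image may leave [U]. *)
Definition subrep_act (h : gT) : 'End(subvs_of U) :=
  linfun (vsproj U \o act A h \o vsval).

Lemma subrep_actE h x : h \in H -> vsval (subrep_act h x) = act A h (vsval x).
Proof.
move=> hH; rewrite lfunE /= vsprojK //.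
by apply: (subvP (invU hH)); rewrite memv_img ?subvsP.
Qed.

Fact subrep_act1 : subrep_act 1%g = \1%VF.
Proof. by apply/lfunP => x; rewrite !lfunE /= act1 lfunE vsvalK. Qed.

Fact subrep_actM : {in H &, forall g h,
  subrep_act (g * h)%g = (subrep_act g \o subrep_act h)%VF}.
Proof.
move=> g h gH hH; apply/lfunP => x; apply: val_inj.
by rewrite /= comp_lfunE !subrep_actE ?groupM // actM // comp_lfunE.
Qed.

Fact subrep_act_unitary : {in H, forall g x y,
  subrep_dot (subrep_act g x) (subrep_act g y) = subrep_dot x y}.
Proof. by move=> g gH x y; rewrite /subrep_dot !subrep_actE // act_unitary. Qed.

Definition subrep : unitary_rep C H :=
  @UnitaryRep C gT H (subvs_of U) subrep_dot
    subrep_act subrep_act1 subrep_actM subrep_act_unitary.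

Definition subrep_incl : 'Hom(subrep, A) := linfun vsval.

Lemma subrep_inclE x : subrep_incl x = vsval x.
Proof. by rewrite lfunE. Qed.

Lemma subrep_incl_Hom : subrep_incl \in Hom_rep subrep A.
Proof. by apply/Hom_repP => h hH x; rewrite !subrep_inclE subrep_actE. Qed.

Lemma subrep_incl_inj : injective subrep_incl.
Proof. by move=> x y; rewrite !subrep_inclE => /val_inj. Qed.

End Subrep.

Lemma orthov_invariant (A : unitary_rep C H) (U : {vspace A}) :
  rep_invariant U -> rep_invariant (orthov (udot A) U).
Proof.
move=> invU h hH; apply/subvP => _ /memv_imgP[x /mem_orthovP xU ->].
apply/mem_orthovP => y yU; apply: etrans (act_adjoint x y hH) _; apply: xU.
by apply: (subvP (invU _ (groupVr hH))); rewrite memv_img.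
Qed.

Lemma orthov_neq0 (A : vectType C) (d : {dot A for conjC}) (U : {vspace A}) :
  U != fullv -> orthov d U != 0%VS.
Proof.
move=> nfU; apply: contra_neq nfU => o0; apply/eqP.
rewrite eqEsubv subvf; apply/subvP => x _.
(* The kernel of this map is the orthogonal complement of [U]. If that is zero, the map embeds [A]
   in a space of dimension dim U, which forces [U] to be everything. *)
pose Gram (y : A) : 'rV[C]_(\dim U) := \row_i d y (vbasis U)`_i.
have Gram_lin : linear Gram.
  by move=> a y z; apply/rowP => i; rewrite !mxE linearPl.
pose GramL := GRing.isSemilinear.Build _ _ _ _ Gram
  (GRing.semilinear_linear Gram_lin).
pose Gramf : {linear A -> 'rV[C]_(\dim U)} := HB.pack Gram GramL.
pose T : 'Hom(A, 'rV[C]_(\dim U)) := linfun Gramf.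
have TE y : T y = Gram y by rewrite lfunE.
have kerT : lker T = 0%VS.
  apply/eqP; rewrite -subv0 -o0; apply/subvP => y.
  rewrite memv_ker TE => /eqP/rowP Gy; apply/mem_orthovP => z.
  move=> /coord_vbasis ->; rewrite linear_sumr big1 // => i _.
  by have := Gy i; rewrite !mxE linearZr_LR /= => ->; rewrite mulr0.
have : (\dim (limg T) <= \dim U)%N.
  by rewrite (leq_trans (dimvS (subvf _))) // dimvf /dim /= mul1n.
rewrite limg_dim_eq ?kerT ?capv0 // => dimU.
by rewrite (eqP (_ : U == fullv)) ?memvf // eqEdim subvf.
Qed.

(** Descend on dimension to a minimal nonzero invariant subspace. Its subrepresentation is
    irreducible, since the inclusion carries any invariant subspace of it to an invariant subspace
    of [A]. *)
Lemma irreducible_in_invariant (A : unitary_rep C H) (U : {vspace A}) :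
  rep_invariant U -> U != 0%VS ->
  exists S : unitary_rep C H, rep_irreducible S /\
    exists T : 'Hom(S, A),
      [/\ T \in Hom_rep S A, injective T & (limg T <= U)%VS].
Proof.
have [n] := ubnP (\dim U); elim: n U => // n IH U leUn invU nzU.
have [[U' [invU' nzU' ltU']]|noU'] := boolp.EM (exists U' : {vspace A},
    [/\ rep_invariant U', U' != 0%VS & (U' <= U)%VS && (U' != U)]).
  have [sU' neU'] := andP ltU'.
  have ltd : (\dim U' < \dim U)%N.
    rewrite ltn_neqAle dimvS // andbT; apply: contra neU' => /eqP e.
    by rewrite eqEdim sU' e /=.
  have [|S [irrS [T [hT injT sT]]]] := IH U' _ invU' nzU'.
    by rewrite (leq_trans ltd) // -ltnS.
  by exists S; split=> //; exists T; split=> //; apply: subv_trans sT sU'.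
exists (subrep invU); split; last first.
  exists (subrep_incl invU); split.
  - exact: subrep_incl_Hom.
  - exact: subrep_incl_inj.
  by apply/subvP => _ /memv_imgP[x _ ->]; rewrite subrep_inclE subvsP.
split=> [|U' invU'].
  by rewrite dimvf /dim /= lt0n dimv_eq0.
pose I := subrep_incl invU.
have sIU : (I @: U' <= U)%VS.
  by apply/subvP => _ /memv_imgP[x _ ->]; rewrite subrep_inclE subvsP.
have dimI : \dim (I @: U') = \dim U'.
  apply: limg_dim_eq; apply/eqP; rewrite -subv0; apply/subvP => x.
  rewrite memv_cap memv_ker => /andP[_ /eqP Ix].
  by rewrite memv0 -(inj_eq (@subrep_incl_inj _ _ invU)) Ix linear0.
have [e|nzI] := eqVneq (I @: U')%VS 0%VS.
  by left; apply/eqP; rewrite -dimv_eq0 -dimI e dimv0.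
right; have [e|neI] := eqVneq (I @: U')%VS U.
  by apply/eqP; rewrite eqEdim subvf -dimI e dimvf /dim /= leqnn.
case: noU'; exists (I @: U')%VS; split=> //; last by rewrite sIU.
move=> h hH; apply/subvP => _ /memv_imgP[_ /memv_imgP[x xU' ->] ->].
have /Hom_repP hI := subrep_incl_Hom invU; rewrite -hI // memv_img //.
by apply: (subvP (invU' h hH)); rewrite memv_img.
Qed.

End Subrepresentations.

(** * The action of L(G) on representations of G *)

Section GroupAlgebraAction.
Variables (C : numClosedFieldType) (gT : finGroupType).
Implicit Types (A B : unitary_rep C [set: gT]%G) (f : LG C gT).

Definition rep_op A f : 'End(A) := \sum_(g : gT) (f g : C) *: act A g.

Lemma rep_opE A f x : rep_op A f x = \sum_(g : gT) (f g : C) *: act A g x.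
Proof. by rewrite sum_lfunE; apply: eq_bigr => g _; rewrite lfunE. Qed.

Lemma rep_op_conv A f1 f2 x :
  rep_op A (conv f1 f2) x = rep_op A f1 (rep_op A f2 x).
Proof.
rewrite !rep_opE.
under eq_bigr => g _ do rewrite ffunE scaler_suml.
rewrite exchange_big /=.
under [RHS]eq_bigr => g _ do rewrite linear_sum scaler_sumr /=.
rewrite [RHS]exchange_big /=; apply: eq_bigr => h _.
rewrite (reindex_inj (mulIg h)) /=; apply: eq_bigr => g _.
by rewrite mulgK linearZ /= scalerA actM ?inE // comp_lfunE.
Qed.

Lemma rep_op_Hom A B (T : 'Hom(A, B)) f x : T \in Hom_rep A B ->
  T (rep_op A f x) = rep_op B f (T x).
Proof.
move=> /Hom_repP hT; rewrite !rep_opE linear_sum; apply: eq_bigr => g _.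
by rewrite linearZ /= hT ?inE.
Qed.

Lemma group_charE A f : group_char A f = lftrace (rep_op A f).
Proof.
rewrite lftrace_sum; apply: eq_bigr => g _.
by rewrite lftraceZ mulrC.
Qed.

(** Complete reducibility in the form required here: an element of L(G) that kills every irreducible
    constituent kills the whole representation. *)
Lemma rep_op_eq0 A f :
  (forall S, rep_irreducible S -> rep_contained S A -> rep_op S f = 0) ->
  rep_op A f = 0.
Proof.
(* The kernel of sigma(f) need not be invariant; [N] is the largest invariant subspace inside it. If
   [N] were proper, an irreducible in its orthogonal complement would be killed by f, hence would
   also lie in [N]. *)
move=> hS; pose N := (\bigcap_(g : gT) lker (rep_op A f \o act A g))%VS.
have NP x : reflect (forall g, rep_op A f (act A g x) = 0) (x \in N).
  rewrite memvE; apply: (iffP subv_bigcapP) => h g => [|_].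
    by have := h g isT; rewrite -memvE memv_ker comp_lfunE => /eqP.
  by rewrite -memvE memv_ker comp_lfunE h.
have invN : rep_invariant N.
  move=> h _; apply/subvP => _ /memv_imgP[x /NP hx ->]; apply/NP => g.
  by rewrite -[act A g _]comp_lfunE -actM ?inE // hx.
have [eN|/(orthov_neq0 (udot A)) nz] := eqVneq N fullv.
  apply/lfunP => x; have /NP/(_ 1%g) : x \in N by rewrite eN memvf.
  by rewrite act1 !lfunE.
have [S [irrS [T [hT injT sT]]]] :=
  irreducible_in_invariant (orthov_invariant invN) nz.
have S0 : rep_op S f = 0 by apply: hS => //; exists T.
have [x xS] : exists x : S, x != 0.
  exists (vpick {:S}); rewrite vpick0 -dimv_eq0 -lt0n; exact: irrS.1.
have TxN : T x \in N.
  apply/NP => g; have /Hom_repP/(_ g) <- := hT; last by rewrite inE.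
  by rewrite -rep_op_Hom // S0 lfunE linear0.
have /mem_orthovP/(_ _ TxN)/eqP : T x \in orthov (udot A) N.
  by apply: (subvP sT); rewrite memv_img ?memvf.
rewrite dnorm_eq0 => /eqP Tx0; case/eqP: xS.
by apply: injT; rewrite Tx0 linear0.
Qed.

Lemma rep_op_equiv A B f : rep_equiv A B -> rep_op B f = 0 -> rep_op A f = 0.
Proof.
move=> [T hT /bij_inj injT] B0; apply/lfunP => x; apply: injT.
by rewrite rep_op_Hom // B0 !lfunE /= linear0.
Qed.

End GroupAlgebraAction.

(** * The function psi, the projection sigma(psi) and the coefficients phi_ij *)

Section HeckeAlgebra.
Variables (C : numClosedFieldType) (gT : finGroupType) (K : {group gT}).
Variables (V : unitary_rep C K) (V_irr : rep_irreducible V).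
Variables (v : V) (v_unit : udot V v v = 1).

Let nzdV : (\dim {:V})%:R != 0 :> C.
Proof. by rewrite pnatr_eq0 -lt0n; case: V_irr. Qed.

Let nzK : #|K|%:R != 0 :> C.
Proof. by rewrite pnatr_eq0 -lt0n cardG_gt0. Qed.

Lemma psi_in g : g \in K ->
  psi v g = (\dim {:V})%:R / #|K|%:R * udot V v (act V g v).
Proof. by move=> gK; rewrite ffunE gK. Qed.

Lemma psi_out g : g \notin K -> psi v g = 0.
Proof. by move=> gK; rewrite ffunE (negPf gK). Qed.

Lemma psiV g : psi v g^-1%g = (psi v g)^*.
Proof.
have [gK|gK] := boolP (g \in K); last first.
  by rewrite !psi_out ?groupV // conjC0.
rewrite !psi_in ?groupV // rmorphM fmorph_div !rmorph_nat /= -dotC.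
by rewrite act_adjoint.
Qed.

Lemma sum_psi (U : lmodType C) (F : gT -> U) :
  \sum_(g : gT) (psi v g : C) *: F g =
  ((\dim {:V})%:R / #|K|%:R) *:
    \sum_(g in K) udot V v (act V g v) *: F g.
Proof.
rewrite (bigID (mem K)) /= [X in _ + X]big1 ?addr0; last first.
  by move=> g gK; rewrite psi_out ?scale0r.
by rewrite scaler_sumr; apply: eq_bigr => g gK; rewrite psi_in // scalerA.
Qed.

(** Pairing with an arbitrary vector turns this into Schur orthogonality on K, whose constant #|K| /
    dim V is cancelled by the normalization of psi. It says that theta(psi) fixes [v]. *)
Lemma psi_reproducing :
  ((\dim {:V})%:R / #|K|%:R) *:
    (\sum_(g in K) udot V v (act V g v) *: act V g v) = v.
Proof.
apply: (@dot_eqP _ _ (udot V)) => z; rewrite linearZl_LR linear_sumlz /=.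
under eq_bigr => g _ do rewrite linearZl_LR /= mulrC (dotC _ v).
rewrite Schur_orthogonality // v_unit mulr1 -dotC mulrA.
by rewrite mulf_div [X in _ / X]mulrC mulfV ?mulf_neq0 // mul1r.
Qed.

Section Multiplicity.
Variables (W : unitary_rep C [set: gT]%G) (m : nat).
Variables (L : 'I_m -> 'Hom(V, Res K W)) (L_basis : orthonormal_Hom_basis L).

Lemma L_Hom i : L i \in Hom_rep V (Res K W).
Proof.
have [bas _] := L_basis; rewrite -(span_basis bas) memv_span //.
exact: codom_f.
Qed.

Lemma L_act i g x : g \in K -> L i (act V g x) = act W g (L i x).
Proof. by move=> gK; have /Hom_repP/(_ g gK x) := L_Hom i. Qed.

Lemma Lv_orthonormal i j : udot W (L i v) (L j v) = (i == j)%:R.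
Proof.
have := Hom_dot_orthonormal v v V_irr (L_Hom j) (L_Hom i).
by rewrite L_basis.2 v_unit mulr1.
Qed.

Lemma Hom_expand (T : 'Hom(V, Res K W)) : T \in Hom_rep V (Res K W) ->
  exists c : 'I_m -> C, T = \sum_i c i *: L i.
Proof.
have [bas _] := L_basis; rewrite -(span_basis bas) span_def big_map.
rewrite big_enum /= => /memv_sumP[t tL ->].
have /fin_all_exists[c hc] i : exists c, t i = c *: L i.
  exact/vlineP/tL.
by exists c; apply: eq_bigr => i _; rewrite hc.
Qed.

(** As psi is supported on K and [L i] commutes with K, this is the image under [L i] of theta(psi)
    v = v. *)
Lemma rep_op_psi_L i : rep_op W (psi v) (L i v) = L i v.
Proof.
rewrite rep_opE sum_psi -[in RHS]psi_reproducing linearZ [in RHS]linear_sum /=.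
congr (_ *: _); apply: eq_bigr => g gK.
by rewrite linearZ /= L_act.
Qed.

(** Comes from [psiV]. It identifies the coefficients in [rep_op_psi]: the component of sigma(psi) w
    along w_j is <w, sigma(psi) w_j> = <w, w_j>. *)
Lemma rep_op_psi_selfadjoint x y :
  udot W (rep_op W (psi v) x) y = udot W x (rep_op W (psi v) y).
Proof.
rewrite !rep_opE linear_sumlz linear_sumr (reindex_inj invg_inj) /=.
apply: eq_bigr => g _; rewrite linearZl_LR linearZr_LR /= psiV.
by rewrite act_adjoint ?inE // invgK.
Qed.

(* The left-hand side is T v for the intertwiner                              *)
(* T x = d_theta / |K| sum_k <x, theta(k) v> sigma(k) w, hence lies in the    *)
(* span of the vectors L_i v.                                                 *)
Lemma rep_op_psi w :
  rep_op W (psi v) w = \sum_i udot W w (L i v) *: L i v.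
Proof.
have [c Tc] := Hom_expand (average_rank_one_Hom (A := Res K W) (B := V) w v).
have Pw : exists c', rep_op W (psi v) w = \sum_i c' i *: L i v.
  exists (fun i => ((\dim {:V})%:R / #|K|%:R) * c i).
  rewrite rep_opE sum_psi; under [RHS]eq_bigr => i _ do rewrite -scalerA.
  rewrite -scaler_sumr; congr (_ *: _).
  have /lfunP/(_ v) := Tc; rewrite !sum_lfunE.
  under eq_bigr => i _ do rewrite rank_oneE.
  by under [X in _ = X]eq_bigr => i _ do rewrite lfunE /=.
have {c Tc Pw} [c Pw] := Pw.
rewrite Pw; apply: eq_bigr => j _; congr (_ *: _).
rewrite -{1}(rep_op_psi_L j) -rep_op_psi_selfadjoint Pw linear_sumlz /=.
rewrite (bigD1 j) //= big1 ?addr0 => [|i nij]; rewrite linearZl_LR /=.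
  by rewrite Lv_orthonormal eqxx mulr1.
by rewrite Lv_orthonormal (negPf nij) mulr0.
Qed.

Lemma fourierE f i j : fourier v L f i j = udot W (rep_op W f (L j v)) (L i v).
Proof.
rewrite mxE /LG_dot rep_opE linear_sumlz; apply: eq_bigr => g _.
by rewrite linearZl_LR ffunE /= -dotC.
Qed.

Lemma fourier_linear a f1 f2 :
  fourier v L (a *: f1 + f2) = a *: fourier v L f1 + fourier v L f2.
Proof. by apply/matrixP => i j; rewrite !mxE linearPl. Qed.

Lemma fourier_psi : fourier v L (psi v) = 1%:M.
Proof.
apply/matrixP => i j.
by rewrite fourierE rep_op_psi_L Lv_orthonormal !mxE eq_sym.
Qed.

(** Writing f2 as psi * f2 places sum_k <., w_k> w_k between the two operators, and this sum is the
    one in the matrix product. *)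
Lemma fourier_conv f1 f2 : conv (psi v) f2 = f2 ->
  fourier v L (conv f1 f2) = fourier v L f1 *m fourier v L f2.
Proof.
move=> psif2; apply/matrixP => i j; rewrite fourierE mxE -{1}psif2.
rewrite !rep_op_conv rep_op_psi linear_sum linear_sumlz /=.
apply: eq_bigr => k _; rewrite linearZ linearZl_LR /=.
by rewrite !fourierE mulrC.
Qed.

Lemma rep_op_fourier0 f : conv (psi v) f = f -> conv f (psi v) = f ->
  fourier v L f = 0 -> rep_op W f = 0.
Proof.
move=> lf rf F0; apply/lfunP => w; rewrite lfunE -rf rep_op_conv.
rewrite rep_op_psi linear_sum big1 // => i _; rewrite linearZ /=.
rewrite -lf rep_op_conv rep_op_psi big1 ?scaler0 // => j _.
by rewrite -fourierE F0 mxE scale0r.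
Qed.

(** sigma(f) = sigma(f) sigma(psi) is a sum of rank-one operators <., w_i> sigma(f) w_i, whose
    traces are the diagonal Fourier entries. *)
Lemma Hecke_char_group f : conv f (psi v) = f ->
  Hecke_char v L f = group_char W f.
Proof.
move=> rf; rewrite group_charE.
have -> : rep_op W f =
    \sum_i rank_one (udot W) (rep_op W f (L i v)) (L i v).
  apply/lfunP => w; rewrite -{1}rf rep_op_conv rep_op_psi linear_sum sum_lfunE.
  by apply: eq_bigr => i _; rewrite rank_oneE linearZ.
rewrite lftrace_sum; apply: eq_bigr => i _.
by rewrite lftrace_rank_one fourierE.
Qed.

Lemma Hecke_charE f :
  Hecke_char v L f = \sum_(g : gT) f g * (phi_sum v L g)^*.
Proof.
rewrite /Hecke_char /mxtrace; under eq_bigr => i _ do rewrite mxE /LG_dot.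
rewrite exchange_big; apply: eq_bigr => g _ /=.
by rewrite -mulr_sumr -rmorph_sum /phi_sum sum_ffunE.
Qed.

Lemma conv_psi_phi i j : conv (psi v) (phi v L i j) = phi v L i j.
Proof.
apply/ffunP => g; rewrite !ffunE -[in RHS]rep_op_psi_L rep_opE linear_sumlz.
rewrite (reindex_inj invg_inj) (reindex_inj (mulgI g^-1%g)) /=.
apply: eq_bigr => h _.
rewrite [phi _ _ _ _ _]ffunE linearZl_LR /= !invgK invMg invgK mulKVg.
by rewrite act_adjoint ?inE // actM ?inE // comp_lfunE.
Qed.

Lemma conv_phi_psi i j : conv (phi v L i j) (psi v) = phi v L i j.
Proof.
apply/ffunP => g; rewrite !ffunE -[in RHS](rep_op_psi_L j) rep_opE.
rewrite linear_sum linear_sumr [RHS](reindex_inj invg_inj) /=.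
apply: eq_bigr => h _.
rewrite [phi _ _ _ _ _]ffunE linearZ linearZr_LR /= psiV conjCK.
by rewrite actM ?inE // comp_lfunE mulrC.
Qed.

(** Since phi_ij(g) is the conjugate of <sigma(g) w_j, w_i>, Schur orthogonality is applied with the
    two coefficients exchanged. *)
Lemma phi_dot i j k l : rep_irreducible W ->
  LG_dot (phi v L i j) (phi v L k l) =
  #|[set: gT]|%:R / (\dim {:W})%:R * (j == l)%:R * (i == k)%:R.
Proof.
move=> irrW.
have := Schur_orthogonality (A := W) (L l v) (L k v) (L j v) (L i v) irrW.
rewrite !Lv_orthonormal conjC_nat (eq_sym l) (eq_sym k) => <-.
apply: eq_big => [g|g _]; first by rewrite inE.
by rewrite !ffunE -!dotC mulrC.
Qed.

End Multiplicity.

Lemma phi_dot_inequiv (W1 W2 : unitary_rep C [set: gT]%G) m1 m2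
    (L1 : 'I_m1 -> 'Hom(V, Res K W1)) (L2 : 'I_m2 -> 'Hom(V, Res K W2))
    i j k l :
  rep_irreducible W1 -> rep_irreducible W2 -> ~ rep_equiv W1 W2 ->
  LG_dot (phi v L1 i j) (phi v L2 k l) = 0.
Proof.
move=> irr1 irr2 neq.
have <- := Schur_orthogonality_inequiv (A := W2) (B := W1)
  (L2 l v) (L2 k v) (L1 j v) (L1 i v) irr2 irr1 neq.
apply: eq_big => [g|g _]; first by rewrite inE.
by rewrite !ffunE -!dotC mulrC.
Qed.

(** For g in K, expand the last [v] in <v, theta(g) v> by [psi_reproducing]; the resulting sum is
    the convolution. For g off K every term vanishes. *)
Lemma conv_psi_psi : conv (psi v) (psi v) = psi v.
Proof.
apply/ffunP => g; rewrite [LHS]ffunE.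
have [gK|gK] := boolP (g \in K); last first.
  rewrite psi_out // big1 // => h _; have [hK|hK] := boolP (h \in K).
    by rewrite psi_out ?mul0r // groupMr ?groupV.
  by rewrite (psi_out hK) mulr0.
rewrite [RHS]psi_in // -[X in act V g X]psi_reproducing -sum_psi.
rewrite linear_sum linear_sumr mulr_sumr [RHS](reindex_inj invg_inj) /=.
apply: eq_bigr => h _; rewrite linearZ linearZr_LR /= psiV conjCK.
have [hK|hK] := boolP (h \in K); last by rewrite (psi_out hK) !(mulr0, mul0r).
rewrite (psi_in (groupM gK (groupVr hK))) actM ?groupV // comp_lfunE.
by rewrite mulrCA [RHS]mulrC -mulrA mulrC mulrA.
Qed.

Lemma conv_psi_Hecke f : f \in Hecke v -> conv (psi v) f = f.
Proof. by move=> /HeckeP[f0 ->]; rewrite !convA conv_psi_psi. Qed.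

Lemma conv_Hecke_psi f : f \in Hecke v -> conv f (psi v) = f.
Proof. by move=> /HeckeP[f0 ->]; rewrite -!convA conv_psi_psi. Qed.

(* f is recovered from its action on the function k |-> theta(k^-1) v         *)
(* supported on K.                                                            *)
Lemma rep_op_Ind_inj f : conv f (psi v) = f -> rep_op (Ind V) f = 0 -> f = 0.
Proof.
move=> rf f0.
pose F0 : {ffun gT -> V} := [ffun g => if g \in K then act V g^-1%g v else 0].
have F0in : F0 \in Ind_space V.
  apply/Ind_spaceP => k kK g; rewrite !ffunE groupMr //; case: ifP => gK.
    by rewrite invMg actM ?groupV // comp_lfunE.
  by rewrite linear0.
have F0E g : psi v g = (\dim {:V})%:R / #|K|%:R * udot V (F0 g) v.
  have [gK|gK] := boolP (g \in K); last first.
    by rewrite psi_out // ffunE (negPf gK) linear0l mulr0.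
  by rewrite psi_in // ffunE gK act_adjoint ?groupV // invgK.
have fF0 x : \sum_(g : gT) (f g : C) *: F0 (g^-1 * x)%g = 0.
  pose x0 : Ind V := vsproj (Ind_space V) F0.
  have : vsval (rep_op (Ind V) f x0) = 0 by rewrite f0 lfunE.
  rewrite rep_opE linear_sum => /ffunP/(_ x); rewrite sum_ffunE ffunE => fx.
  rewrite -[RHS]fx; apply: eq_bigr => g _.
  by rewrite linearZ /= Ind_actE vsprojK // !ffunE.
apply/ffunP => x; rewrite -rf !ffunE.
under eq_bigr => h _ do rewrite F0E mulrCA.
rewrite -mulr_sumr; apply/eqP; rewrite mulf_eq0; apply/orP; right.
have /(congr1 (fun z => udot V z v)) := fF0 x.
rewrite linear_sumlz linear0l (reindex_inj invg_inj).
rewrite (reindex_inj (mulIg x^-1%g)) /= => {2}<-; apply/eqP/eq_bigr => h _.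
by rewrite linearZl_LR /= invgK mulgKV invMg !invgK.
Qed.

End HeckeAlgebra.

(** * Fourier inversion and the orthogonal basis of the Hecke algebra *)

Section HeckeFourier.
Variables (C : numClosedFieldType) (gT : finGroupType) (K : {group gT}).
Variables (V : unitary_rep C K) (V_irr : rep_irreducible V).
Variables (v : V) (v_unit : udot V v v = 1).
Variables (J : finType) (W : J -> unitary_rep C [set: gT]%G).
Hypothesis W_irr : forall s, rep_irreducible (W s).
Hypothesis W_inequiv : forall s r, rep_equiv (W s) (W r) -> s = r.
Hypothesis W_complete : forall S : unitary_rep C [set: gT]%G,
  rep_irreducible S -> rep_contained S (Ind V) -> exists s, rep_equiv S (W s).
Variables (m : J -> nat) (L : forall s, 'I_(m s) -> 'Hom(V, Res K (W s))).
Hypothesis L_basis : forall s, orthonormal_Hom_basis (@L s).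

Local Notation G := [set: gT].
Local Notation d s := (\dim {:W s})%:R.
Local Notation phi_ s := (phi v (@L s)).

Let nzG : #|G|%:R != 0 :> C.
Proof. by rewrite pnatr_eq0 -lt0n cardG_gt0. Qed.

Let nzd s : d s != 0 :> C.
Proof. by rewrite pnatr_eq0 -lt0n; case: (W_irr s). Qed.

Lemma phi_Hecke s i j : phi_ s i j \in Hecke v.
Proof.
by apply/HeckeP; exists (phi_ s i j); rewrite conv_psi_phi // conv_phi_psi.
Qed.

(** A Hecke element with zero transform acts as zero on every [W s], hence by completeness on all
    irreducibles contained in [Ind V], hence on [Ind V], where Hecke elements act faithfully. *)
Lemma fourier_inj f1 f2 : f1 \in Hecke v -> f2 \in Hecke v ->
  (forall s, fourier v (@L s) f1 = fourier v (@L s) f2) -> f1 = f2.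
Proof.
move=> f1H f2H F12; apply/eqP; rewrite -subr_eq0; apply/eqP.
have fH : f1 - f2 \in Hecke v by rewrite memvB.
have lf := conv_psi_Hecke V_irr v_unit fH.
have rf := conv_Hecke_psi V_irr v_unit fH.
apply: (rep_op_Ind_inj rf); apply: rep_op_eq0 => S irrS inS.
have [s eqS] := W_complete irrS inS; apply: (rep_op_equiv eqS).
apply: (rep_op_fourier0 V_irr v_unit (L_basis s) lf rf).
by rewrite addrC -scaleN1r fourier_linear F12 scaleN1r addNr.
Qed.

(** The weights d_s / #|G| are the reciprocals of the squared norms of the phi_ij. *)
Definition inverse_fourier (A : forall s, 'M[C]_(m s)) : LG C gT :=
  #|G|%:R^-1 *: \sum_s d s *: \sum_i \sum_j A s i j *: phi_ s i j.

Lemma inverse_fourier_Hecke A : inverse_fourier A \in Hecke v.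
Proof.
apply/memvZ/memv_suml => s _; apply/memvZ/memv_suml => i _.
by apply: memv_suml => j _; apply/memvZ/phi_Hecke.
Qed.

Lemma inverse_fourierK A s : fourier v (@L s) (inverse_fourier A) = A s.
Proof.
apply/matrixP => k l; rewrite mxE linearZl_LR linear_sumlz /=.
(* Orthogonality leaves only the term of index (s, k, l), whose weight cancels the squared norm. *)
rewrite (bigD1 s) //= [X in _ + X]big1 ?addr0 => [|r nrs]; last first.
  rewrite linearZl_LR linear_sumlz /= big1 ?mulr0 // => i _.
  rewrite linear_sumlz big1 //= => j _; rewrite linearZl_LR /=.
  rewrite phi_dot_inequiv ?mulr0 // => /W_inequiv rs.
  by rewrite rs eqxx in nrs.
rewrite linearZl_LR linear_sumlz (bigD1 k) //= [X in _ + X]big1 ?addr0;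
  last first.
  move=> i nik; rewrite linear_sumlz big1 //= => j _.
  by rewrite linearZl_LR /= phi_dot // (negPf nik) !mulr0.
rewrite linear_sumlz (bigD1 l) //= [X in _ + X]big1 ?addr0; last first.
  move=> j njl; rewrite linearZl_LR /= phi_dot // (negPf njl).
  by rewrite mulr0 mul0r mulr0.
rewrite linearZl_LR /= phi_dot // !eqxx !mulr1 mulrCA mulrA.
by rewrite mulrCA mulf_div [X in _ / X]mulrC mulfV ?mulf_neq0 // mulr1.
Qed.

(** Both sides lie in the Hecke algebra and have the same transform, so injectivity applies. *)
Lemma fourierK f : f \in Hecke v ->
  f = inverse_fourier (fun s => fourier v (@L s) f).
Proof.
move=> fH; apply: fourier_inj => // [|s]; first exact: inverse_fourier_Hecke.
by rewrite inverse_fourierK.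
Qed.

Local Notation I := {s : J & ('I_(m s) * 'I_(m s))%type}.

Definition phi_tagged (t : I) : LG C gT :=
  phi_ (tag t) (tagged t).1 (tagged t).2.

Lemma phi_tagged_dot t u :
  LG_dot (phi_tagged t) (phi_tagged u) = (t == u)%:R * (#|G|%:R / d (tag t)).
Proof.
case: t u => [s [i j]] [r [k l]]; rewrite /phi_tagged /=.
have [esr|nsr] := eqVneq s r; last first.
  rewrite phi_dot_inequiv => [|//|//|/W_inequiv/eqP]; last exact/negP.
  by rewrite -tag_eqE /tag_eq /= (negPf nsr) mul0r.
case: r / esr k l => k l; rewrite phi_dot // eq_Tagged /= xpair_eqE.
by rewrite -mulrA -natrM mulnb andbC mulrC.
Qed.

Lemma phi_tagged_ortho : pairwise_orthogonal (@LG_dot C gT)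
  [seq phi_tagged t | t : I].
Proof.
(* Pairwise orthogonality of a sequence includes absence of repetitions: two equal members with
   different indices would have a zero scalar product equal to a nonzero squared norm. *)
have phi_inj : injective phi_tagged.
  move=> t u etu; have := phi_tagged_dot t u.
  rewrite -etu phi_tagged_dot eqxx mul1r; have [//|_] := eqVneq t u.
  rewrite mul0r => /eqP.
  by rewrite mulf_eq0 invr_eq0 (negPf nzG) (negPf (nzd _)).
apply/pairwise_orthogonalP; split=> [|_ _ /imageP[t _ ->] /imageP[u _ ->] ntu].
  rewrite /= map_inj_uniq ?enum_uniq // andbT.
  apply/negP => /imageP[t _ /esym t0]; have := phi_tagged_dot t t.
  rewrite t0 linear0l eqxx mul1r => /esym/eqP.
  by rewrite mulf_eq0 invr_eq0 (negPf nzG) (negPf (nzd _)).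
rewrite /= phi_tagged_dot; have [etu|_] := eqVneq t u; last by rewrite mul0r.
by rewrite etu eqxx in ntu.
Qed.

Lemma phi_tagged_basis : basis_of (Hecke v) [seq phi_tagged t | t : I].
Proof.
rewrite /basis_of (orthogonal_free phi_tagged_ortho) andbT eqEsubv.
apply/andP; split.
  by apply/span_subvP => _ /imageP[t _ ->]; apply: phi_Hecke.
apply/subvP => f /fourierK ->.
apply/memvZ/memv_suml => s _; apply/memvZ/memv_suml => i _.
apply: memv_suml => j _; apply/memvZ/memv_span/imageP.
by exists (Tagged (fun s => 'I_(m s) * 'I_(m s))%type (i, j)).
Qed.

Lemma phi_sum_dot s r : LG_dot (phi_sum v (@L s)) (phi_sum v (@L r)) =
  (s == r)%:R * (#|G|%:R * (m s)%:R / d s).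
Proof.
rewrite /phi_sum linear_sumlz.
have [<-|nsr] := eqVneq s r; last first.
  rewrite mul0r big1 // => i _; rewrite linear_sumr big1 // => j _.
  by apply: phi_dot_inequiv => // /W_inequiv e; rewrite e eqxx in nsr.
rewrite mul1r (eq_bigr (fun=> #|G|%:R / d s)) => [|i _].
  by rewrite sumr_const card_ord mulrAC mulr_natr.
rewrite linear_sumr (bigD1 i) //= big1 ?addr0 => [|j nji].
  by rewrite phi_dot // eqxx !mulr1.
by rewrite phi_dot // eq_sym (negPf nji) mulr0.
Qed.

End HeckeFourier.

Theorem theorem5p7 (R : realType) (gT : finGroupType) (K : {group gT})
    (V : unitary_rep R[i] K) (V_irr : rep_irreducible V)
    (v : V) (v_unit : udot V v v = 1)
    (J : finType) (W : J -> unitary_rep R[i] [set: gT]%G)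
    (W_irr : forall s, rep_irreducible (W s))
    (W_inequiv : forall s r, rep_equiv (W s) (W r) -> s = r)
    (W_in_Ind : forall s, rep_contained (W s) (Ind V))
    (W_complete : forall S : unitary_rep R[i] [set: gT]%G,
       rep_irreducible S -> rep_contained S (Ind V) ->
       exists s, rep_equiv S (W s))
    (m : J -> nat)
    (m_mult : forall s, rep_multiplicity (W s) (Ind V) (m s))
    (L : forall s, 'I_(m s) -> 'Hom(V, Res K (W s)))
    (L_basis : forall s, orthonormal_Hom_basis (L s)) :
  let G : {set gT} := [set: gT] in
  let H : {vspace LG R[i] gT} := Hecke v in
  let d s : R[i] := (\dim {:W s})%:R in
  let dot : LG R[i] gT -> LG R[i] gT -> R[i] := @LG_dot R[i] gT in
  let F (f : LG R[i] gT) s : 'M[R[i]]_(m s) := fourier v (L s) f in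
  let Phi : seq (LG R[i] gT) :=
    [seq phi v (L (tag t)) (tagged t).1 (tagged t).2
       | t : {s : J & ('I_(m s) * 'I_(m s))%type}] in
  [/\ [/\ basis_of H Phi,
          pairwise_orthogonal (@LG_dot R[i] gT) Phi,
          forall s i j,
            dot (phi v (L s) i j) (phi v (L s) i j) = #|G|%:R / d s
        & forall f, f \in H ->
            f = #|G|%:R^-1 *:
                \sum_s d s *: \sum_i \sum_j F f s i j *: phi v (L s) i j],
      [/\ {in H &, forall f1 f2 (a : R[i]) s,
             F (a *: f1 + f2) s = a *: F f1 s + F f2 s},
          {in H &, forall f1 f2 s, F (conv f1 f2) s = F f1 s *m F f2 s},
          forall s, F (psi v) s = 1%:M,
          {in H &, forall f1 f2, (forall s, F f1 s = F f2 s) -> f1 = f2}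
        & forall A : forall s, 'M[R[i]]_(m s),
            exists2 f, f \in H & forall s, F f s = A s]
    & [/\ forall s f, f \in H ->
            Hecke_char v (L s) f = group_char (W s) f,
          forall s f, f \in H ->
            group_char (W s) f = \sum_(g : gT) f g * (phi_sum v (L s) g)^*
        & forall s r,
            dot (phi_sum v (L s)) (phi_sum v (L r)) =
              (s == r)%:R * (#|G|%:R * (m s)%:R / d s)]].
Proof.
move=> G H d dot F Phi; split; [split|split|split].
- exact: phi_tagged_basis.
- exact: phi_tagged_ortho.
- by move=> s i j; rewrite /dot phi_dot // !eqxx !mulr1.
- by move=> f; apply: fourierK.
- by move=> f1 f2 _ _ a s; apply: fourier_linear.
- by move=> f1 f2 _ f2H s; apply: fourier_conv => //; apply: conv_psi_Hecke.
- by move=> s; apply: fourier_psi.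
- by move=> f1 f2; apply: fourier_inj.
- move=> A; exists (inverse_fourier v L A); first exact: inverse_fourier_Hecke.
  by move=> s; apply: inverse_fourierK.
- by move=> s f fH; apply: Hecke_char_group => //; apply: conv_Hecke_psi.
- move=> s f fH; rewrite -Hecke_charE; apply/esym/Hecke_char_group => //.
  exact: conv_Hecke_psi.
- by move=> s r; apply: phi_sum_dot.
Qed.
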